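(* Let $r\in\mathbb{N}$, $m_1,\ldots,m_r\in\mathbb{N}$, $m=\operatorname{lcm}(m_1,\ldots,m_r)$ and $\mathbf a=(a_1,\ldots,a_r)\in\mathbb{Z}^r$. Then $$R_{(\mathbf a)}(m_1,\ldots,m_r):=\sum_{\substack{k=1\\ \gcd(k,m)=1}}^m c_{m_1}(k-a_1)\cdots c_{m_r}(k-a_r)=\phi(m)\sum_{d_1\mid m_1,\ldots,d_r\mid m_r}\frac{d_1\mu(m_1/d_1)\cdots d_r\mu(m_r/d_r)}{\phi(\operatorname{lcm}(d_1,\ldots,d_r))}\eta_{(\mathbf a)}(d_1,\ldots,d_r),$$ where $\eta_{(\mathbf a)}(d_1,\ldots,d_r)=1$ if $\gcd(d_i,a_i)=1$ for all $1\le i\le r$ and $\gcd(d_i,d_j)\mid a_i-a_j$ for all $1\le i,j\le r$, and $\eta_{(\mathbf a)}(d_1,\ldots,d_r)=0$ otherwise.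
   Context: For $n\in\mathbb{N}$ and $k\in\mathbb{Z}$, $c_n(k)=\sum_{1\le j\le n,\ \gcd(j,n)=1}\exp(2\pi i jk/n)$ is the Ramanujan sum. $\mu$ is the Möbius function, $\phi$ Euler's totient. *)

(* Defs.v *)
From mathcomp Require Export all_boot all_order all_algebra.
From mathcomp Require Export reals sequences exp trigo.
From mathcomp Require Export complex.
Set Implicit Arguments.
Unset Strict Implicit.
Unset Printing Implicit Defensive.
Import Order.TTheory GRing.Theory Num.Theory.
Local Open Scope ring_scope.
Local Open Scope complex_scope.

Definition cexp (R : realType) (z : R[i]) : R[i] :=
  (expR (complex.Re z))%:C * (cos (complex.Im z) +i* sin (complex.Im z)).

Definition ramanujan_sum (R : realType) (n : nat) (k : int) : R[i] :=
  \sum_(1 <= j < n.+1 | coprime j n)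
    cexp (2 * (pi : R)%:C * 'i%C * j%:R * k%:~R / n%:R).

(* n is squarefree iff every prime divisor of n has exponent 1; the value at
   n = 0 is a convention. *)
Definition moebius (n : nat) : int :=
  if (0 < n)%N && all (fun p => logn p n == 1%N) (primes n)
  then (-1) ^+ size (primes n) else 0.

Definition lcm_fam (r : nat) (m : 'I_r -> nat) : nat :=
  \big[lcmn/1%N]_(i < r) m i.

Definition Rsum (R : realType) (r : nat) (a : 'I_r -> int) (m : 'I_r -> nat)
    : R[i] :=
  \sum_(1 <= k < (lcm_fam m).+1 | coprime k (lcm_fam m))
    \prod_(i < r) ramanujan_sum R (m i) (k%:Z - a i).

Definition eta (r : nat) (a : 'I_r -> int) (d : 'I_r -> nat) : nat :=
  if [forall i, gcdz (d i)%:Z (a i) == 1] &&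
     [forall i, forall j, (gcdz (d i)%:Z (d j)%:Z %| a i - a j)%Z]
  then 1%N else 0%N.

(* Main.v *)
(** Writing c_n(k) as the sum of d mu(n/d) over the common divisors d of n and k,
and expanding the product, the coefficient of each divisor tuple (d_1, ..., d_r)
becomes the number of units k modulo m with k = a_i mod d_i for all i.  Such a
unit can exist only if eta = 1, and then, by the Chinese remainder theorem for
non-coprime moduli, the system is a single congruence k = y mod lcm(d_1, ..., d_r)
with y a unit.  The reduction (Z/m)^* -> (Z/lcm(d_1, ..., d_r))^* is surjective
with fibres of equal size, so the number is phi(m) / phi(lcm(d_1, ..., d_r)). *)
Require Import Defs.
From mathcomp Require Import zify ring lra.
Set Implicit Arguments.
Unset Strict Implicit.
Unset Printing Implicit Defensive.
Import Order.TTheory GRing.Theory Num.Theory.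
Local Open Scope ring_scope.
Local Open Scope complex_scope.

(** * Möbius function and sums over divisors *)

Lemma moebius_pM (p d : nat) : prime p -> (0 < d)%N ->
  moebius (p * d) = if (p %| d)%N then 0 else - moebius d.
Proof.
move=> p_pr d0; have p0 := prime_gt0 p_pr.
have lp : logn p (p * d) = (logn p d).+1 by rewrite lognM // logn_prime // eqxx.
(* If p divides d, its exponent in p d is at least 2. Otherwise p d has one more prime than d and
   all other exponents are unchanged, so only the sign flips. *)
rewrite /moebius muln_gt0 p0 d0 /=; case pd: (p %| d)%N.
  rewrite ifN //; apply/allPn; exists p.
    by rewrite primesM // primes_prime // inE eqxx.
  by rewrite lp eqSS -lt0n logn_gt0 mem_primes p_pr d0.
have pNd : p \notin primes d by rewrite mem_primes p_pr d0 pd.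
have pE : perm_eq (primes (p * d)) (p :: primes d).
  apply: uniq_perm => [||q]; first exact: primes_uniq.
    by rewrite /= pNd primes_uniq.
  by rewrite primesM // primes_prime // !inE.
have -> : all (fun q => logn q (p * d) == 1%N) (primes (p * d)) =
          all (fun q => logn q d == 1%N) (primes d).
  rewrite (perm_all _ pE) /= lp eqSS [logn p d]lognE p_pr d0 pd eqxx /=.
  apply: eq_in_all => q qd; rewrite lognM // logn_prime //.
  by have [qp|] := eqVneq q p; first by rewrite qp (negbTE pNd) in qd.
rewrite (perm_size pE) /=; case: ifP => _; last by rewrite oppr0.
by rewrite exprS mulN1r.
Qed.

(** For a prime p dividing n = p q, the divisors p d with d | q contribute - mu(d) when p does not
    divide d and 0 otherwise. The divisors of n prime to p are those of q prime to p, so everything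
    cancels. *)
Lemma sum_moebius (n : nat) : (0 < n)%N ->
  \sum_(d <- divisors n) moebius d = (n == 1%N)%:R.
Proof.
move=> n0; case: eqP => [->|/eqP n1].
  by rewrite (_ : divisors 1 = [:: 1%N]) // big_seq1.
have n_gt1 : (1 < n)%N by lia.
have [p p_pr pn] : exists2 p, prime p & (p %| n)%N.
  by exists (pdiv n); rewrite ?pdiv_prime ?pdiv_dvd.
have p0 := prime_gt0 p_pr; have pE := divnK pn; set q := (n %/ p)%N in pE.
have q0 : (0 < q)%N by rewrite divn_gt0 // dvdn_leq.
rewrite (bigID (fun d => p %| d)%N) /= -big_filter.
rewrite (perm_big [seq (p * d)%N | d <- divisors q]); last first.
  apply: uniq_perm => [||d].
  - exact/filter_uniq/divisors_uniq.
  - rewrite map_inj_uniq ?divisors_uniq // => x y /eqP.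
    by rewrite eqn_pmul2l // => /eqP.
  rewrite mem_filter -dvdn_divisors //; apply/andP/mapP => [[/dvdnP[e ->]]|[e]].
    rewrite -pE dvdn_pmul2r // => eq; exists e; last by rewrite mulnC.
    by rewrite -dvdn_divisors.
  by rewrite -dvdn_divisors // => eq ->; rewrite -pE mulnC dvdn_mull // dvdn_pmul2r.
rewrite big_map big_seq.
rewrite (eq_bigr (fun d => if ~~ (p %| d)%N then - moebius d else 0)); last first.
  move=> d; rewrite -dvdn_divisors // => dq.
  by rewrite moebius_pM //; [case: (p %| d)%N | exact: dvdn_gt0 dq].
rewrite -big_seq -big_mkcond /= sumrN addrC; apply/eqP; rewrite subr_eq0; apply/eqP.
rewrite -big_filter -[RHS]big_filter; apply: perm_big.
apply: uniq_perm => [||d]; try exact/filter_uniq/divisors_uniq.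
rewrite !mem_filter -!dvdn_divisors //; case pd : (p %| d)%N => //=.
by rewrite -pE Gauss_dvdl // coprime_sym prime_coprime // pd.
Qed.

(** The bound N may exceed n, so that a single index type can serve all the m_i. *)
Lemma sum_divisors (T : nmodType) (n N : nat) (F : nat -> T) :
  (0 < n <= N)%N ->
  \sum_(d < N.+1 | (d %| n)%N) F d = \sum_(d <- divisors n) F d.
Proof.
case/andP=> n0 nN; rewrite -(big_mkord (fun d => d %| n)%N F) -big_filter.
apply: perm_big; apply: uniq_perm => [||d].
- by rewrite filter_uniq ?iota_uniq.
- exact: divisors_uniq.
rewrite mem_filter -dvdn_divisors // mem_index_iota ltnS.
by case dn : (d %| n)%N => //=; apply: leq_trans (dvdn_leq n0 dn) nN.
Qed.

(** * Chinese remainder theorem for non-coprime moduli *)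

Lemma chinese_pair (d l : nat) (a x : int) :
  (gcdz d%:Z l%:Z %| a - x)%Z ->
  exists y : int, (d%:Z %| y - a)%Z /\ (l%:Z %| y - x)%Z.
Proof.
case/dvdzP=> q qE; have [u [v uvE]] := Bezoutz d%:Z l%:Z.
(* Since a - x = q gcd(d, l) and gcd(d, l) = u d + v l, this differs from a by - q u d. *)
exists (x + q * (v * l%:Z)); split.
  apply/dvdzP; exists (- (q * u)).
  have -> : x + q * (v * l%:Z) - a = q * (v * l%:Z) - (a - x) by ring.
  by rewrite qE -uvE; ring.
by apply/dvdzP; exists (q * v); ring.
Qed.

Lemma chinese_seq (I : eqType) (s : seq I) (d : I -> nat) (a : I -> int) :
  (forall i j, (gcdz (d i)%:Z (d j)%:Z %| a i - a j)%Z) ->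
  exists x : int, forall i, i \in s -> ((d i)%:Z %| x - a i)%Z.
Proof.
move=> da; elim: s => [|i s [x xP]]; first by exists 0.
pose l := \big[lcmn/1%N]_(j <- s) d j.
(* The new congruence is compatible with the class of x modulo l because gcd distributes over lcm,
   which reduces the claim to the pairwise conditions. *)
have gl : (gcdz (d i)%:Z l%:Z %| a i - x)%Z.
  rewrite -[(_ %| _)%Z]/(gcdn (d i) l %| `|(a i - x)%R|)%N.
  rewrite gcdnC /l; elim: s xP {l} => [|j s IHs] xP.
    by rewrite big_nil gcd1n dvd1n.
  rewrite big_cons Order.NatDvd.meetUl dvdn_lcm IHs ?andbT; last first.
    by move=> k ks; apply: xP; rewrite inE ks orbT.
  have dj : ((gcdn (d j) (d i))%:Z %| x - a j)%Z.
    apply: dvdz_trans (xP j (mem_head _ _)).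
    exact: dvdn_gcdl.
  have dij : ((gcdn (d j) (d i))%:Z %| a j - a i)%Z := da j i.
  have : ((gcdn (d j) (d i))%:Z %| - ((x - a j) + (a j - a i)))%Z.
    by rewrite rpredN rpredD.
  by rewrite (_ : - _ = a i - x) //; ring.
have [y [yi yl]] := chinese_pair gl.
exists y => j; rewrite inE => /orP[/eqP->//|js].
have -> : y - a j = (y - x) + (x - a j) by ring.
rewrite rpredD ?xP //; apply: dvdz_trans yl.
rewrite /dvdz /= /l; apply: (@dvdn_trans (d j)) => //.
by rewrite (big_rem j) //= dvdn_lcml.
Qed.

(** * Units modulo m in a residue class modulo a divisor D *)

(* Split m into its part at the primes of D, where u is taken congruent to c,
   and the complementary part, where u is taken congruent to 1. *)
Lemma coprime_lift (D m c : nat) : (0 < m)%N -> (D %| m)%N -> coprime c D ->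
  exists2 u, coprime u m & u = c %[mod D].
Proof.
move=> m0 Dm cD; have D0 := dvdn_gt0 m0 Dm.
set b := (m`_\pi(D))%N; set b' := (m`_(\pi(D)^'))%N.
have bb' : coprime b b' := coprime_partC _ _ _.
have Db : (D %| b)%N by rewrite -{1}(partn_pi D0) partn_dvd.
(* Adding D keeps the class and makes the number positive; c may be 0 when D = 1. *)
have cb : coprime b (c + D).
  apply: (@pnat_coprime \pi(D)); first exact: part_pnat.
  by rewrite -coprime_pi' // ?addn_gt0 ?D0 ?orbT // -coprime_modr modnDr coprime_modr coprime_sym.
exists (chinese b b' (c + D) 1).
  rewrite -(partnC \pi(D) m0) coprimeMr; apply/andP; split.
    by rewrite coprime_sym -coprime_modr chinese_modl // coprime_modr.
  by rewrite coprime_sym -coprime_modr chinese_modr // coprime_modr coprimen1.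
by rewrite -(modn_dvdm _ Db) chinese_modl // modn_dvdm // modnDr.
Qed.

Lemma eqn_modM2r (u m k l : nat) : coprime u m ->
  (k * u == l * u %[mod m])%N = (k == l %[mod m])%N.
Proof.
move=> um; wlog kl : k l / (k <= l)%N => [hw|].
  by case/orP: (leq_total k l) => /hw // h; rewrite eq_sym h eq_sym.
rewrite eq_sym eqn_mod_dvd ?leq_mul // -mulnBl Gauss_dvdl 1?coprime_sym //.
by rewrite -eqn_mod_dvd // eq_sym.
Qed.

Lemma coprime_fiber_card (D m x : nat) : (0 < m)%N -> (D %| m)%N -> coprime x D ->
  (totient D * \sum_(k < m | coprime k m) (k == x %[mod D]) = totient m)%N.
Proof.
move=> m0 Dm xD; have D0 := dvdn_gt0 m0 Dm.
pose N y := (\sum_(k < m | coprime k m) (k == y %[mod D]))%N.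
have NE y : coprime y D -> N y = N x.
  move=> yD.
  (* By Euler's theorem a power of x is an inverse of x modulo D. *)
  have [x' x'x] : exists x', (x' * x)%N = 1 %[mod D].
    by exists (x ^ (totient D).-1)%N; rewrite -expnSr prednK ?totient_gt0 // cyclic.Euler_exp_totient.
  have x'D : coprime x' D.
    have: coprime D (x' * x) by rewrite -coprime_modr x'x coprime_modr coprimen1.
    by rewrite coprimeMr coprime_sym => /andP[].
  have [u um uE] : exists2 u, coprime u m & u = (y * x')%N %[mod D].
    by apply: coprime_lift => //; rewrite coprimeMl yD.
  have ltm k : (k * u %% m < m)%N by rewrite ltn_mod.
  pose f (k : 'I_m) := Ordinal (ltm k).
  have f_inj : injective f.
    move=> k l /(congr1 val) /= /eqP.
    by rewrite eqn_modM2r // !modn_small // => /eqP kl; apply: val_inj.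
  (* As u = y x' modulo D, multiplication by u carries the fibre of x onto the fibre of y. *)
  rewrite {1}/N (reindex_inj f_inj) /=; apply: eq_big => [k|k _].
    by rewrite coprime_sym coprime_modr coprimeMr coprime_sym [coprime m u]coprime_sym um andbT.
  rewrite modn_dvdm //; congr (nat_of_bool _).
  rewrite -(@eqn_modM2r (y * x') D k) ?coprimeMl ?yD // -modnMmr uE modnMmr.
  by rewrite [(x * _)%N]mulnC -[(y * x' * x)%N]mulnA -[(y * _ %% D)%N]modnMmr x'x modnMmr muln1.
(* Every unit k modulo m lies in exactly one fibre, that of k mod D. *)
have <- : (\sum_(y < D | coprime y D) N y = totient m)%N.
  rewrite /N (exchange_big_dep (fun k : 'I_m => coprime k m)) //=.
  rewrite totient_count_coprime big_mkord [RHS](eq_bigr (fun k : 'I_m => if coprime k m then 1 else 0)%N); last first.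
    by move=> k _; rewrite coprime_sym; case: coprime.
  rewrite -big_mkcond /=; apply: eq_bigr => k km.
  have kD : (k %% D < D)%N by rewrite ltn_mod.
  rewrite (bigD1 (Ordinal kD)) /=; last first.
    by rewrite coprime_sym coprime_modr coprime_sym km andbT; apply: coprime_dvdr km.
  rewrite modn_mod eqxx big1 // => y /andP[_ yk].
  by apply/eqP; rewrite eqb0 eq_sym; apply: contra yk; rewrite (modn_small (ltn_ord y)) => /eqP h; apply/eqP/val_inj.
rewrite [RHS](eq_bigr (fun=> N x)) => [|y]; last exact: NE.
rewrite totient_count_coprime big_mkord big_distrl [RHS]big_mkcond /=.
by apply: eq_bigr => y _; rewrite coprime_sym; case: coprime; rewrite ?mul1n.
Qed.

(** * The exponential exp(ix) for real x, and when it equals 1 *)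

Definition cis (R : realType) (x : R) : R[i] := cos x +i* sin x.

Lemma cisD (R : realType) (x y : R) : cis (x + y) = cis x * cis y.
Proof.
rewrite /cis cosD sinD; apply/eqP; rewrite eq_complex /= eqxx /=.
by rewrite addrC eqxx.
Qed.

Lemma cis0 (R : realType) : cis (0 : R) = 1.
Proof. by rewrite /cis cos0 sin0. Qed.

Lemma cisX (R : realType) (x : R) (n : nat) : cis (x *+ n) = cis x ^+ n.
Proof.
elim: n => [|n IHn]; first by rewrite mulr0n cis0 expr0.
by rewrite mulrS cisD IHn exprS.
Qed.

Lemma cis_2pi (R : realType) : cis (2 * pi : R) = 1.
Proof. by rewrite /cis mulr_natl cos2pi sin2pi. Qed.

Lemma cis_2pi_int (R : realType) (q : int) : cis (2 * pi * q%:~R : R) = 1.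
Proof.
case: q => n; first by rewrite -pmulrn mulr_natr cisX cis_2pi expr1n.
have h : cis (2 * pi * n.+1%:R : R) = 1 by rewrite mulr_natr cisX cis_2pi expr1n.
have : cis (2 * pi * n.+1%:R + 2 * pi * (Negz n)%:~R : R) = 1.
  by rewrite NegzE rmorphN /= mulrN addrN cis0.
by rewrite cisD h mul1r.
Qed.

Lemma cis_neq1 (R : realType) (x : R) : 0 < x < 2 * pi -> cis x != 1.
Proof.
move=> /andP[x0 x2]; rewrite eq_complex /= negb_and; apply/orP; left.
have s0 : 0 < sin (x / 2) by apply: sin_gt0_pi; lra.
have -> : x = x / 2 + x / 2 by lra.
(* cos x = 1 - 2 sin(x/2)^2 is less than 1, as x/2 lies strictly between 0 and pi. *)
rewrite cosD; have := cos2Dsin2 (x / 2); rewrite !expr2 => cs.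
by apply/eqP => h; nra.
Qed.

Lemma cis_eq1 (R : realType) (d : nat) (k : int) : (0 < d)%N ->
  (cis (2 * pi * k%:~R / d%:R : R) == 1) = (d%:Z %| k)%Z.
Proof.
move=> d0; have dR : 0 < d%:R :> R by rewrite ltr0n.
have pi0 := pi_gt0 R.
(* Reducing k modulo d removes whole turns and leaves an angle in [0, 2 pi). *)
have -> : cis (2 * pi * k%:~R / d%:R : R) = cis (2 * pi * (k %% d%:Z)%Z%:~R / d%:R : R).
  rewrite {1}(divz_eq k d%:Z) rmorphD rmorphM /= -pmulrn.
  have -> : 2 * pi * ((k %/ d)%Z%:~R * d%:R + (k %% d)%Z%:~R) / d%:R =
    2 * pi * (k %/ d)%Z%:~R + 2 * pi * (k %% d)%Z%:~R / d%:R :> R.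
    by field; rewrite lt0r_neq0.
  by rewrite cisD cis_2pi_int mul1r.
have dz : d%:Z != 0 by lia.
have := modz_ge0 k dz; have := ltz_pmod k (d0 : 0 < d%:Z).
have -> : (d%:Z %| k)%Z = ((k %% d)%Z == 0) by apply/dvdz_mod0P/eqP.
 case: (k %% d)%Z => [[|j]|//] jd _.
  by rewrite mulr0 mul0r cis0 eqxx.
rewrite -pmulrn; apply/negbTE/cis_neq1.
have j0 : 0 < j.+1%:R :> R by rewrite ltr0n.
have jR : j.+1%:R < d%:R :> R by rewrite ltr_nat.
by rewrite ltr_pdivrMr // divr_gt0 ?mulr_gt0 // ltr_pM2l ?mulr_gt0.
Qed.

(** * Geometric sums and the divisor form of Ramanujan sums *)

Lemma sum_expr_unity_root (F : fieldType) (w : F) (n : nat) : w ^+ n = 1 ->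
  \sum_(1 <= j < n.+1) w ^+ j = if w == 1 then n%:R else 0.
Proof.
move=> wn; rewrite big_add1 /= big_mkord; case: eqP => [->|/eqP w1].
  by rewrite (eq_bigr (fun=> 1)) ?sumr_const ?card_ord // => i _; rewrite expr1n.
have := subrX1 w n; rewrite wn subrr => /esym/eqP.
rewrite mulf_eq0 subr_eq0 (negbTE w1) /= => /eqP s0.
by under eq_bigr do rewrite exprS; rewrite -big_distrr /= s0 mulr0.
Qed.

Lemma cexp_rat (R : realType) (n j : nat) (k : int) :
  cexp (2 * (pi : R)%:C * 'i%C * j%:R * k%:~R / n%:R) =
  cis (2 * pi * k%:~R / n%:R : R) ^+ j.
Proof.
pose f : {rmorphism R -> R[i]} := real_complex R.
have -> : 2 * (pi : R)%:C * 'i%C * j%:R * k%:~R / n%:R =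
   'i%C * f (2 * pi * k%:~R / n%:R * j%:R : R) :> R[i].
  rewrite 4!rmorphM fmorphV !rmorph_nat rmorph_int.
  by rewrite -[(pi : R)%:C]/(f pi); ring.
rewrite -cisX -[X in cis X]mulr_natr; set x := _ / _ * _.
have -> : 'i%C * f x = 0 +i* x.
  rewrite -[f x]/(x +i* 0); apply/eqP; rewrite eq_complex /=.
  by rewrite mul0r mulr0 subrr eqxx mul1r mul0r add0r /=.
by rewrite /cexp /= expR0 -[1%:C]/(1 : R[i]) mul1r.
Qed.

(** The coprimality condition becomes the sum of mu(e) over e | gcd(j, n). With n = d e, the terms j
    = e l, 1 <= l <= d, form a full sum of powers of exp(2 pi i k/d), which is d if d | k and 0
    otherwise. *)
Lemma ramanujan_sum_divisors (R : realType) (n : nat) (k : int) : (0 < n)%N ->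
  ramanujan_sum R n k =
  \sum_(d <- divisors n) d%:R * (moebius (n %/ d))%:~R * (d%:Z %| k)%Z%:R.
Proof.
move=> n0; pose w := cis (2 * pi * k%:~R / n%:R : R).
rewrite /ramanujan_sum (eq_bigr (fun j => w ^+ j)); last by move=> j _; rewrite cexp_rat.
have nR : n%:R != 0 :> R by rewrite pnatr_eq0 -lt0n.
pose G e : R[i] := \sum_(1 <= j < n.+1 | (e %| j)%N) w ^+ j.
have -> : \sum_(1 <= j < n.+1 | coprime j n) w ^+ j =
          \sum_(e <- divisors n) (moebius e)%:~R * G e.
  under [RHS]eq_bigr do rewrite /G big_distrr /=.
  rewrite (exchange_big_dep xpredT) //= big_mkcond /=; apply: eq_big_nat => j /andP[j0 _].
  rewrite -big_distrl /= -big_filter.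
  have g0 : (0 < gcdn j n)%N by rewrite gcdn_gt0 j0.
  rewrite (perm_big (divisors (gcdn j n))); last first.
    apply: uniq_perm => [||e]; first exact/filter_uniq/divisors_uniq.
      exact: divisors_uniq.
    by rewrite mem_filter -!dvdn_divisors // dvdn_gcd.
  rewrite -rmorph_sum /= sum_moebius // /coprime.
  by case: eqP; rewrite ?mul1r ?mul0r.
have divnn d : (d %| n)%N -> (n %/ (n %/ d))%N = d.
  move=> dn; have e0 : (0 < n %/ d)%N.
    by rewrite divn_gt0 ?(dvdn_gt0 n0 dn) //; exact: dvdn_leq.
  have := mulKn d e0; rewrite divnK //.
(* Pass to the complementary divisor d = n/e. *)
rewrite (perm_big [seq (n %/ d)%N | d <- divisors n]); last first.
  apply: uniq_perm => [||e]; first exact: divisors_uniq.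
    rewrite map_inj_in_uniq ?divisors_uniq // => x y; rewrite -!dvdn_divisors //.
    by move=> xn yn xy; rewrite -(divnn x) // xy divnn.
  rewrite -dvdn_divisors //; apply/idP/mapP => [en|[d]].
    by exists (n %/ e)%N; rewrite ?divnn // -dvdn_divisors // dvdn_div.
  by rewrite -dvdn_divisors // => dn ->; rewrite dvdn_div.
rewrite big_map big_seq [RHS]big_seq; apply: eq_bigr => d; rewrite -dvdn_divisors // => dn.
have d0 := dvdn_gt0 n0 dn.
have eE := divnK dn; set e := (n %/ d)%N in eE *.
have e0 : (0 < e)%N by rewrite divn_gt0 // dvdn_leq.
rewrite mulrAC [RHS]mulrC; congr (_ * _).
have weE : w ^+ e = cis (2 * pi * k%:~R / d%:R).
  rewrite -cisX -[X in cis X]mulr_natr -eE natrM; congr cis.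
  by field; rewrite !pnatr_eq0 -!lt0n e0 d0.
rewrite /G -big_filter (perm_big [seq (e * l)%N | l <- index_iota 1 d.+1]); last first.
  apply: uniq_perm => [||j].
  - by rewrite filter_uniq ?iota_uniq.
  - by rewrite map_inj_uniq ?iota_uniq // => x y /eqP; rewrite eqn_pmul2l // => /eqP.
  rewrite mem_filter mem_index_iota; apply/andP/mapP => [[/dvdnP[l ->]]|[l]].
    rewrite muln_gt0 ltnS -eE mulnC leq_pmul2l // => /andP[/andP[l0 _] ld].
    by exists l; rewrite // mem_index_iota l0 ltnS.
  rewrite mem_index_iota ltnS => /andP[l0 ld] ->.
  split; first exact: dvdn_mulr.
  by rewrite muln_gt0 e0 l0 ltnS -eE leq_pmul2l.
rewrite big_map; under eq_bigr do rewrite exprM.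
rewrite sum_expr_unity_root; last first.
  by rewrite weE -cisX -[X in cis X]mulr_natr divfK ?pnatr_eq0 -?lt0n // cis_2pi_int.
by rewrite weE cis_eq1 //; case: (_ %| _)%Z; rewrite ?mulr1 ?mulr0.
Qed.

(** * Counting the units that solve a system of congruences *)

Lemma sum_nat_shift (F : nat -> nat) (M : nat) : F M = F 0%N ->
  (\sum_(1 <= k < M.+1) F k = \sum_(k < M) F k)%N.
Proof.
move=> FM; have := @big_nat_recl _ 0%N addn M 0 F (leq0n M).
rewrite big_nat_recr //= FM addnC => /addnI; rewrite big_mkord => ->.
by rewrite big_add1.
Qed.

Lemma dvdn_lcm_fam (r : nat) (d : 'I_r -> nat) (M : nat) :
  (lcm_fam d %| M)%N = [forall i, d i %| M]%N.
Proof.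
by apply/dvdn_biglcmP/forallP => [h i|h i _]; [exact: h|exact: h].
Qed.

Lemma dvdn_fam_lcm (r : nat) (d : 'I_r -> nat) i : (d i %| lcm_fam d)%N.
Proof. by move: i; apply/forallP; rewrite -dvdn_lcm_fam. Qed.

Lemma lcm_fam_gt0 (r : nat) (d : 'I_r -> nat) :
  (forall i, 0 < d i)%N -> (0 < lcm_fam d)%N.
Proof.
move=> d0; rewrite /lcm_fam; elim/big_ind: _ => // x y x0 y0.
by rewrite lcmn_gt0 x0.
Qed.

Lemma coprime_lcm_fam (r : nat) (d : 'I_r -> nat) y :
  (forall i, coprime y (d i)) -> coprime y (lcm_fam d).
Proof.
move=> yd; rewrite /lcm_fam; elim/big_ind: _ => [|u v yu yv|i _] //.
  exact: coprimen1.
apply: (@coprime_dvdr _ (u * v)%N); last by rewrite coprimeMr yu.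
by rewrite dvdn_lcm dvdn_mulr // dvdn_mull.
Qed.

(** gcd(d_i, a_i) divides both k and M, hence is 1; gcd(d_i, d_j) divides the difference of k - a_j
    and k - a_i. *)
Lemma eta_coprime_solution (r M : nat) (a : 'I_r -> int) (d : 'I_r -> nat) (k : nat) :
  (forall i, d i %| M)%N -> coprime k M ->
  (forall i, ((d i)%:Z %| k%:Z - a i)%Z) -> eta a d = 1%N.
Proof.
move=> dM kM kd; rewrite /eta ifT //; apply/andP; split.
  apply/forallP => i.
  suff : (gcdz (d i) (a i) %| 1)%Z by rewrite dvdz1 eqz_nat.
  have : (gcdz (d i) (a i) %| (gcdn k M)%:Z)%Z.
    rewrite -[Posz (gcdn k M)]/(gcdz k M) dvdz_gcd; apply/andP; split.
      rewrite -[k%:Z](subrK (a i)) rpredD ?dvdz_gcdr //.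
      by apply: dvdz_trans (kd i); exact: dvdz_gcdl.
    by apply: (@dvdz_trans (d i)%:Z); [exact: dvdz_gcdl|exact: dM].
  by rewrite (eqP kM).
apply/forallP => i; apply/forallP => j.
have -> : a i - a j = (k%:Z - a j) - (k%:Z - a i) by ring.
by rewrite rpredB //; [apply: dvdz_trans (kd j); exact: dvdz_gcdr
  | apply: dvdz_trans (kd i); exact: dvdz_gcdl].
Qed.

Lemma eta_solvable (r : nat) (a : 'I_r -> int) (d : 'I_r -> nat) :
  (forall i, 0 < d i)%N -> eta a d = 1%N ->
  exists2 y : nat, coprime y (lcm_fam d) &
    forall k : nat, [forall i, ((d i)%:Z %| k%:Z - a i)%Z] =
                    (k == y %[mod lcm_fam d])%N.
Proof.
move=> d0; have D0 := lcm_fam_gt0 d0; rewrite /eta; set D := lcm_fam d in D0 *.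
case: ifP => // /andP[/forallP da /forallP daa] _.
have [x xP] : exists x : int, forall i, i \in enum 'I_r -> ((d i)%:Z %| x - a i)%Z.
  by apply: chinese_seq => i j; exact: (forallP (daa i)).
have {}xP i : ((d i)%:Z %| x - a i)%Z by apply: xP; rewrite mem_enum.
have [y yE] : exists y : nat, y%:Z = (x %% D)%Z.
  exists `|(x %% D)%Z|%N; rewrite gez0_abs // modz_ge0 //; lia.
have xyD : (D%:Z %| x - y%:Z)%Z by rewrite -eqz_mod_dvd yE modz_mod.
have diD i : ((d i)%:Z %| D%:Z)%Z := dvdn_fam_lcm d i.
have yP i : ((d i)%:Z %| y%:Z - a i)%Z.
  have -> : y%:Z - a i = (x - a i) - (x - y%:Z) by ring.
  by rewrite rpredB ?xP // (dvdz_trans (diD i)).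
exists y.
  apply: coprime_lcm_fam => i.
  suff : ((gcdn y (d i))%:Z %| gcdz (d i) (a i))%Z by rewrite (eqP (da i)) dvdz1.
  rewrite dvdz_gcd; apply/andP; split; first exact: dvdn_gcdr.
  have -> : a i = y%:Z - (y%:Z - a i) by ring.
  rewrite rpredB //; first exact: dvdn_gcdl.
  by apply: dvdz_trans (yP i); exact: dvdn_gcdr.
move=> k; have -> : (k == y %[mod D])%N = (D%:Z %| k%:Z - y%:Z)%Z.
  by rewrite -eqz_mod_dvd !modz_nat eqz_nat.
rewrite -[RHS]/(lcm_fam d %| `|(k%:Z - y%:Z)%R|)%N dvdn_lcm_fam; apply: eq_forallb => i.
have -> : k%:Z - a i = (k%:Z - y%:Z) + (y%:Z - a i) by ring.
by rewrite rpredDr.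
Qed.

(** The totient of the lcm stands as a factor on the left so that the count stays in the naturals,
    without division. *)
Lemma coprime_solution_count (r M : nat) (a : 'I_r -> int) (d : 'I_r -> nat) :
  (0 < M)%N -> (forall i, d i %| M)%N ->
  (totient (lcm_fam d) *
   \sum_(1 <= k < M.+1 | coprime k M) [forall i, ((d i)%:Z %| (k%:Z - a i)%R)%Z]
   = totient M * eta a d)%N.
Proof.
move=> M0 dM; have d0 i : (0 < d i)%N := dvdn_gt0 M0 (dM i).
have [eta1|etaN1] := eqVneq (eta a d) 1%N; last first.
  have -> : eta a d = 0%N by move: etaN1; rewrite /eta; case: ifP.
  rewrite muln0 big1 ?muln0 // => k kM; apply/eqP; rewrite eqb0.
  by apply: contra etaN1 => /forallP kd; rewrite (eta_coprime_solution dM kM).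
have DM : (lcm_fam d %| M)%N by rewrite dvdn_lcm_fam; apply/forallP.
have [y yD yP] := eta_solvable d0 eta1.
rewrite eta1 muln1 -(coprime_fiber_card M0 DM yD); congr (_ * _)%N.
under eq_bigr do rewrite yP.
(* The range 1..M may be replaced by 0..M-1: 0 and M have the same gcd with M and the same residue
   modulo the lcm, which divides M. *)
rewrite big_mkcond sum_nat_shift /=; first by rewrite -big_mkcond.
by rewrite /coprime gcdnn gcd0n (eqP DM) mod0n.
Qed.

(** * Expansion of the product over divisor tuples *)

Lemma prod_nat_bool (I : finType) (b : pred I) :
  (\prod_i b i = [forall i, b i])%N.
Proof.
have [/forallP bT|] := boolP [forall i, b i]; first by rewrite big1 // => i _; rewrite bT.
by rewrite negb_forall => /existsP[i /negbTE bi]; rewrite (bigD1 i) //= bi mul0n.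
Qed.

(* The divisor tuples are finite functions into 'I_(lcm(m_1, ..., m_r)).+1: each
   d_i divides m_i > 0, hence is at most the lcm, so none is lost. *)
Theorem corollary8 (R : realType) (r : nat) (m : 'I_r -> nat) (a : 'I_r -> int)
    (r_gt0 : (0 < r)%N) (m_gt0 : forall i, (0 < m i)%N) :
  Rsum R a m =
  (totient (lcm_fam m))%:R *
  \sum_(d : {ffun 'I_r -> 'I_(lcm_fam m).+1} | [forall i, (d i %| m i)%N])
     (\prod_(i < r) ((d i)%:R * (moebius (m i %/ d i))%:~R))
     / (totient (lcm_fam (fun i => d i)))%:R
     * (eta a (fun i => d i))%:R.
Proof.
rewrite /Rsum; have M0 := lcm_fam_gt0 m_gt0.
have mM i : (m i <= lcm_fam m)%N := dvdn_leq M0 (dvdn_fam_lcm m i).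
set M := lcm_fam m in M0 mM *.
pose F i (k d : nat) : R[i] :=
  d%:R * (moebius (m i %/ d))%:~R * (d%:Z %| k%:Z - a i)%Z%:R.
(* Distributing the product of divisor sums gives one sum over tuples. *)
rewrite (eq_bigr (fun k : nat => \sum_(d in family (fun i (e : 'I_M.+1) => (e %| m i)%N))
    \prod_(i < r) F i k (d i))); last first.
  move=> k _; rewrite -(bigA_distr_big_dep (fun i (e : 'I_M.+1) => (e %| m i)%N)
    (fun i e => F i k e)); apply: eq_bigr => i _.
  by rewrite ramanujan_sum_divisors // -(@sum_divisors _ _ M) ?m_gt0 ?mM.
rewrite exchange_big big_distrr /=; apply: eq_big => [d|d].
  by apply/familyP/forallP.
move/familyP => dm.
have dM i : (d i %| M)%N by apply: dvdn_trans (dvdn_fam_lcm m i); exact: dm.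
have tD : (totient (lcm_fam (fun i => d i)))%:R != 0 :> R[i].
  rewrite pnatr_eq0 -lt0n totient_gt0 lcm_fam_gt0 // => i.
  exact: dvdn_gt0 M0 (dM i).
(* The product of the divisibility indicators is the indicator of the whole system, so the sum over
   k becomes the count of its solutions. *)
under eq_bigr => k _.
  rewrite big_split /= -natr_prod prod_nat_bool.
  over.
rewrite -big_distrr /= -natr_sum mulrA [RHS]mulrAC.
set P := \prod_(i < r) _; set S := (\sum_(_ <= _ < _ | _) _)%N.
have := coprime_solution_count a M0 dM; rewrite -/S => /(congr1 (fun n => n%:R : R[i])).
rewrite !natrM => h.
apply: (mulfI tD); rewrite mulrCA h; field; exact: tD.
Qed.
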